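(* Let $x>0$ be a real number, $p\ge 2$ and $d\ge 1$ integers, and $r$ a real number. Let $g_p(t)=\frac{1}{t^p-x}$ and let $\{\mathbf{H}_n\}_{n\ge 0}$ be the sequence of Householder's method of order $d$ for $\sqrt[p]{x}$ with starting point $r$: $$\mathbf{H}_0=r,\qquad \mathbf{H}_{n+1}=\mathbf{H}_n+d\,\frac{g_p^{(d-1)}(\mathbf{H}_n)}{g_p^{(d)}(\mathbf{H}_n)}\quad(n\ge 0),$$ assumed to be well defined, i.e. $\mathbf{H}_n^p\neq x$ and $g_p^{(d)}(\mathbf{H}_n)\neq 0$ for all $n\ge 0$. Then $\mathbf{H}_0=r$ and for every integer $n\ge 0$, $$\mathbf{H}_{n+1}=\sqrt[p]{x}\;\frac{\left[B_p^{d+1}\right]_{(1-d)\bmod p}\left(\mathbf{H}_n x^{-1/p}\right)}{\left[B_p^{d+1}\right]_{(-d)\bmod p}\left(\mathbf{H}_n x^{-1/p}\right)},$$ and equivalently $$\mathbf{H}_{n+1}=\frac{\displaystyle\sum_{k=0}^{\left\lfloor\frac{(p-1)d+1}{p}\right\rfloor}\binom{d+1}{p(k+1)-2}_p\mathbf{H}_n^{\,d(p-1)+1-pk}\,x^k}{\displaystyle\sum_{k=0}^{\left\lfloor\frac{(p-1)d}{p}\right\rfloor}\binom{d+1}{p(k+1)-1}_p\mathbf{H}_n^{\,d(p-1)-pk}\,x^k}.$$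
   Context: $g_p^{(m)}$ denotes the $m$-th derivative of $g_p$ ($g_p^{(0)}=g_p$). $B_p(t)=1+t+\cdots+t^{p-1}$. The generalized binomial coefficients of order $p$, $\binom{n}{m}_p$, are defined by $B_p(t)^n=\sum_{m=0}^{(p-1)n}\binom{n}{m}_p t^m$. For a function $f$, $\xi=\exp(2i\pi/p)$ and $\ell\in\{0,\ldots,p-1\}$, the root of unity filter is $[f]_\ell(t)=\frac1p\sum_{k=0}^{p-1}\xi^{-\ell k}f(\xi^k t)$. Here $a\bmod p$ denotes the representative of $a$ in $\{0,\ldots,p-1\}$, $\sqrt[p]{x}$ and $x^{-1/p}$ are positive real, and $0^0=1$. *)

(* Defs.v *)
From HB Require Import structures.
From mathcomp Require Import all_boot all_order all_algebra.
From mathcomp Require Import complex.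
From mathcomp Require Import all_classical all_reals all_analysis.

Set Implicit Arguments.
Unset Strict Implicit.
Unset Printing Implicit Defensive.

Import Order.TTheory GRing.Theory Num.Theory.
Import numFieldNormedType.Exports.
Local Open Scope complex_scope.
Local Open Scope ring_scope.

Definition Bpoly (K : nzSemiRingType) (p : nat) : {poly K} :=
  \sum_(i < p) 'X^i.

Definition gbinom (p n m : nat) : nat := ((Bpoly nat p ^+ n)`_m)%R.

(* exp(2 i pi / p), spelled with Euler's formula. *)
Definition xi (R : realType) (p : nat) : R[i] :=
  cos (2 * pi / p%:R) +i* sin (2 * pi / p%:R).

(* The index l is any integer; since xi^p = 1, the filter depends only on
   l mod p. *)
Definition unity_filter (R : realType) (p : nat) (l : int) (f : R[i] -> R[i])
    (t : R[i]) : R[i] :=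
  p%:R^-1 * \sum_(k < p) xi R p ^ (- (l * k%:Z)) * f (xi R p ^+ k * t).

Definition gp (R : realType) (p : nat) (x : R) : R -> R :=
  fun t => (t ^+ p - x)^-1.

Definition householder_step (R : realType) (p d : nat) (x t : R) : R :=
  t + d%:R * (derive1n d.-1 (gp p x) t / derive1n d (gp p x) t).

Definition householder (R : realType) (p d : nat) (x r : R) (n : nat) : R :=
  iter n (householder_step p d x) r.

(* [gp] and [householder_step] are totalised by 0^-1 = 0; this excludes every
   use of that convention along the orbit of r. *)
Definition householder_well_defined (R : realType) (p d : nat) (x r : R) :=
  forall n, householder p d x r n ^+ p != x /\
            derive1n d (gp p x) (householder p d x r n) != 0.

Definition proot (R : realType) (p : nat) (x : R) : R := x `^ (p%:R^-1).

(* Main.v *)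
Require Import Defs.
From mathcomp Require Import all_boot all_order all_algebra.
From mathcomp Require Import complex.
From mathcomp Require Import all_classical all_reals all_analysis.
From mathcomp Require Import ring lra zify.

Set Implicit Arguments.
Unset Strict Implicit.
Unset Printing Implicit Defensive.

Import Order.TTheory GRing.Theory Num.Theory.
Import numFieldNormedType.Exports.
Local Open Scope complex_scope.
Local Open Scope ring_scope.

(** Put [P = X^p - x], [a = x^(1/p)], and let [w] run over the complex [p]-th
roots [a xi^(-k)] of [x].  With the cofactors [L_w = P / (X - w)], partial
fractions give [1 / P = sum_w c_w / (X - w)] where [c_w = w / (p x)], that is
[sum_w c_w L_w = 1].  Differentiating each fraction [n] times,
[[
  (1 / P)^(n) = (-1)^n n! (sum_w c_w L_w^(n+1)) / P^(n+1).
]]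
The Householder update multiplied by the [d]-th derivative is
[t g^(d) + d g^(d-1)], and [X L_w^(d+1) - P L_w^d = w L_w^(d+1)] because
[P = (X - w) L_w]; so
[[
  H' = (sum_w w^2 L_w(H)^(d+1)) / (sum_w w L_w(H)^(d+1)).
]]
Both closed forms come from evaluating [sum_w w^j L_w(H)^(d+1)] for [j = 1, 2]
in two ways.

- [L_w(T)] is the homogenization [sum_i T^(p-1-i) w^i] of [B_p], so its power
  [d+1] expands with the coefficients of [B_p^(d+1)]; summing over [w] keeps
  only the exponents [m] with [p] dividing [m + j] ([sum_quot_expr]).
- [L_w(T) = w^(p-1) B_p(T / w)], and [T / w = xi^k (T / a)], so the same sum is
  a root of unity filter at [T / a] ([sum_quot_filter]).

The derivatives are real while the roots are complex.  The two sides meet in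
the numerator polynomial [recip_num P n] of the [n]-th derivative of [1 / P]:
it is defined by a recursion over any commutative ring, hence commutes with the
embedding of the reals into the complex numbers.  In particular the real
denominator of the second formula is, up to the factor [(-1)^d d!], the
numerator of the [d]-th derivative, so it does not vanish
([recip_num_XnsubC], [recip_num_XnsubC_step]). *)

(** * Derivatives of the reciprocal of a polynomial *)

(** The numerator of the [n]-th derivative of [1 / P] over the denominator
[P ^+ n.+1]; the recursion is the quotient rule without cancellation. *)
Fixpoint recip_num (A : comNzRingType) (P : {poly A}) (n : nat) : {poly A} :=
  if n is m.+1
  then P * (recip_num P m)^`() - (P^`() * recip_num P m) *+ m.+1
  else 1.

Lemma map_recip_num (A B : comNzRingType) (f : {rmorphism A -> B})
    (P : {poly A}) n :
  map_poly f (recip_num P n) = recip_num (map_poly f P) n.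
Proof.
elim: n => [|n IH] /=; first by rewrite rmorph1.
by rewrite rmorphB rmorphMn !rmorphM -IH !deriv_map.
Qed.

(** The induction needs the formula for the previous derivative on a
neighbourhood of [t], which is where the openness of [P.[s] != 0] enters. *)
Lemma derive1n_recip (R : realType) (P : {poly R}) (n : nat) (t : R) :
  P.[t] != 0 ->
  derive1n n (fun s => P.[s]^-1) t = (recip_num P n).[t] / P.[t] ^+ n.+1.
Proof.
elim: n t => [|n IH] t Pt0.
  by rewrite derive1n0 hornerE expr1 mul1r.
rewrite derive1nS derive1E.
set N := recip_num P n in IH *.
pose G := horner N * (fun s => (P.[s] ^+ n.+1)^-1).
have nearG : \forall s \near t, derive1n n (fun s => P.[s]^-1) s = G s.
  have: \forall s \near t, P.[s] != 0.
    have cP : {for t, continuous (horner P)} by exact: continuous_horner.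
    exact: cvgr_neq0 cP Pt0.
  by apply: filterS => s Ps0; rewrite IH.
rewrite (near_eq_derive _ nearG).
have dP : is_derive t (1 : R) (fun s => P.[s] ^+ n.+1)
    ((n.+1%:R * P.[t] ^+ n) *: (P^`()).[t]).
  rewrite -[fun s => _]exprfctE; exact: is_deriveX.
have dV := @is_deriveV R (fun s => P.[s] ^+ n.+1) _ _ _ (expf_neq0 n.+1 Pt0) dP.
have dG := is_deriveM (is_derive_poly N t) dV.
rewrite (@derive_val _ _ _ _ _ _ _ dG) /= -/N !hornerE /= hornerMn hornerM.
rewrite /GRing.scale /= -[(_ * N.[t]) *+ _]mulr_natl.
have Pn0 := expf_neq0 n Pt0.
rewrite !exprS; field.
by rewrite Pn0 Pt0.
Qed.

(** Each [c_k / (X - w_k)] contributes [(-1)^n n! c_k / (X - w_k)^(n+1)] to the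
[n]-th derivative of [1 / P]; multiplied by [P ^+ n.+1] this is
[(-1)^n n! c_k L_k^(n+1)].  Stated through the recursion of [recip_num], the
fact needs neither division nor analysis, so that it is available over the
complex numbers. *)
Lemma recip_num_partial_fraction (A : comNzRingType) (I : finType)
    (P : {poly A}) (w c : I -> A) (L : I -> {poly A}) (n : nat) :
  (forall k, P = ('X - (w k)%:P) * L k) ->
  \sum_k c k *: L k = 1 ->
  recip_num P n =
    ((-1) ^+ n * n`!%:R) *: \sum_k c k *: L k ^+ n.+1.
Proof.
move=> PE sum1; elim: n => [|n IH].
  by rewrite expr0 fact0 mul1r scale1r /= -sum1; apply: eq_bigr.
have step k : P * (L k ^+ n.+1)^`() - (P^`() * L k ^+ n.+1) *+ n.+1 =
    - n.+1%:R *: L k ^+ n.+2.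
  rewrite deriv_exp /= {1 2}(PE k) derivM derivXsubC !exprS scaleNr scaler_nat.
  ring.
have -> : (-1) ^+ n.+1 * n.+1`!%:R = ((-1) ^+ n * n`!%:R) * - n.+1%:R :> A.
  by rewrite exprS factS natrM; ring.
rewrite /= IH derivZ -!scalerAr scalerMnr -scalerBr -scalerA; congr (_ *: _).
rewrite raddf_sum /= !mulr_sumr -sumrMnl -sumrB scaler_sumr.
apply: eq_bigr => k _.
rewrite derivZ -!scalerAr scalerMnr -scalerBr step !scalerA; congr (_ *: _).
by rewrite mulrC.
Qed.

(** * Homogenized powers of the geometric sum *)

Lemma Bpoly_poly (K : nzSemiRingType) p : Bpoly K p = \poly_(i < p) 1.
Proof. by rewrite poly_def; apply: eq_bigr => i _; rewrite scale1r. Qed.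

(** The homogenization of degree [D] of [q] in [u] and [v], with the monomial
[u ^+ i] still marked by the power ['X^i]: products can then be compared
coefficient by coefficient, and the value at 1 forgets the marking. *)
Definition hpoly (A : comNzRingType) (u v : A) (D : nat) (q : {poly nat}) :
    {poly A} := \poly_(i < D.+1) (((q`_i)%R%:R : A) * v ^+ (D - i) * u ^+ i).

Lemma hpolyM (A : comNzRingType) (u v : A) (D1 D2 : nat) (q1 q2 : {poly nat}) :
  (size q1 <= D1.+1)%N -> (size q2 <= D2.+1)%N ->
  hpoly u v D1 q1 * hpoly u v D2 q2 = hpoly u v (D1 + D2) (q1 * q2).
Proof.
move=> sz1 sz2; apply/polyP => m; rewrite coefM coef_poly coefM.
have [m_small | m_big] := ltnP m (D1 + D2).+1; last first.
  apply: big1 => i _; rewrite !coef_poly.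
  case: ltnP => [iD1|]; rewrite ?mul0r //.
  by case: ltnP => [|]; rewrite ?mulr0 //; lia.
rewrite raddf_sum !mulr_suml; apply: eq_bigr => i _; rewrite !coef_poly /=.
case: ltnP => [iD1 | iD1]; last first.
  by rewrite [q1`_i]nth_default ?(leq_trans sz1) // !mul0r.
case: ltnP => [iD2 | iD2]; last first.
  by rewrite [q2`__]nth_default ?(leq_trans sz2) // !mulr0 !mul0r.
have -> : (D1 + D2 - m = (D1 - i) + (D2 - (m - i)))%N by have := ltn_ord i; lia.
have -> : u ^+ m = u ^+ (m - i) * u ^+ i by rewrite -exprD subnK // -ltnS.
rewrite natrM exprD; ring.
Qed.

(** Homogenizing, instead of writing [v ^+ p.-1 * (Bpoly A p).[u / v]], keeps
the identity valid for [v = 0], that is for an iterate equal to 0. *)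
Lemma homogeneous_geom_expr (A : comNzRingType) (u v : A) (p n : nat) :
  (0 < p)%N ->
  (\sum_(i < p) v ^+ (p.-1 - i) * u ^+ i) ^+ n =
  \sum_(m < (p.-1 * n).+1)
     (gbinom p n m)%:R * v ^+ (p.-1 * n - m) * u ^+ m.
Proof.
case: p => // p _ /=.
have szB : (size (Bpoly nat p.+1) <= p.+1)%N by rewrite Bpoly_poly size_poly.
have szX k : (size (Bpoly nat p.+1 ^+ k) <= (p * k).+1)%N.
  elim: k => [|k IH]; first by rewrite expr0 size_poly1.
  by rewrite exprS (leq_trans (size_polyMleq _ _)) // mulnS; lia.
have hX k : hpoly u v p (Bpoly nat p.+1) ^+ k =
    hpoly u v (p * k) (Bpoly nat p.+1 ^+ k).
  elim: k => [|k IH].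
    rewrite !expr0 muln0; apply/polyP => -[|i];
    by rewrite coef_poly !coef1 ?expr0 ?mulr1.
  by rewrite exprS IH hpolyM ?mulnS -?exprS.
have := congr1 (horner^~ 1) (hX n); rewrite horner_exp !horner_poly => E.
transitivity ((\sum_(i < p.+1)
    ((Bpoly nat p.+1)`_i)%R%:R * v ^+ (p - i) * u ^+ i * 1 ^+ i) ^+ n).
  congr (_ ^+ _); apply: eq_bigr => i _.
  by rewrite Bpoly_poly coef_poly ltn_ord expr1n mulr1 mul1r.
by rewrite E; apply: eq_bigr => i _; rewrite expr1n mulr1.
Qed.

(** * Sums over the roots of X^p - a^p *)

(** Since [0 < j <= p], the indices [m] with [p %| m + j] are the
[p * k.+1 - j]. *)
Lemma sum_dvdn (A : nmodType) (p j N : nat) (G : nat -> A) :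
  (0 < j <= p)%N ->
  \sum_(0 <= m < N | (p %| m + j)%N) G m =
  \sum_(0 <= k < (N + j.-1) %/ p) G (p * k.+1 - j)%N.
Proof.
move=> /andP[j0 jp]; elim: N => [|N IH].
  by rewrite divn_small ?big_geq //; lia.
rewrite big_mkcond big_nat_recr // -big_mkcond IH /=.
have -> : (N.+1 + j.-1 = (N + j.-1).+1)%N by lia.
rewrite divnS; last by lia.
have -> : ((N + j.-1).+1 = N + j)%N by lia.
case: ifP => pNj; last by rewrite addr0.
rewrite add1n big_nat_recr //; congr (_ + G _).
have := divnK pNj; have := divnS (N + j.-1) (leq_trans j0 jp).
have -> : ((N + j.-1).+1 = N + j)%N by lia.
by rewrite pNj add1n => ->; rewrite mulnC; lia.
Qed.

(** A geometric sum whose ratio [z ^+ e] is a [p]-th root of unity. *)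
Lemma sum_prim_root_expr (F : fieldType) (p e : nat) (z : F) :
  p.-primitive_root z ->
  \sum_(k < p) (z ^+ k) ^+ e = if (p %| e)%N then p%:R else 0.
Proof.
move=> zP; under eq_bigr => k _ do rewrite exprAC.
have [pe | pe] := ifPn.
  move: pe; rewrite (prim_order_dvd zP) => /eqP->.
  by under eq_bigr => k _ do rewrite expr1n; rewrite sumr_const card_ord.
have ze : z ^+ e - 1 != 0 by rewrite subr_eq0 -(prim_order_dvd zP).
apply: (mulfI ze); rewrite -subrX1 mulr0 exprAC (prim_expr_order zP).
by rewrite expr1n subrr.
Qed.

Lemma sum_scaled_root_expr (F : fieldType) (p : nat) (z a : F) (e : nat) :
  p.-primitive_root z ->
  \sum_(k < p) (a * z ^+ k) ^+ e = if (p %| e)%N then p%:R * a ^+ e else 0.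
Proof.
move=> zP; under eq_bigr => k _ do rewrite exprMn.
by rewrite -mulr_sumr (sum_prim_root_expr _ zP); case: ifP;
   rewrite ?mulr0 // mulrC.
Qed.

(** The numerator ([j = 2]) and the denominator ([j = 1]) of the second closed
form, as functions of [X = x] and [T], the current iterate. *)
Definition gbinom_sum (A : nzSemiRingType) (p d j : nat) (X T : A) : A :=
  \sum_(0 <= k < (((p - 1) * d + j.-1) %/ p).+1)
    (gbinom p d.+1 (p * k.+1 - j))%:R * T ^+ (d * (p - 1) + j.-1 - p * k)
      * X ^+ k.

(** Expand the power, exchange the sums, and apply orthogonality: only the
exponents [m] with [p %| m + j] survive. *)
Lemma sum_root_geom_expr (F : fieldType) (p d j : nat) (z a T : F) :
  p.-primitive_root z -> (0 < j <= p)%N ->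
  \sum_(k < p) (a * z ^+ k) ^+ j *
    (\sum_(i < p) T ^+ (p.-1 - i) * (a * z ^+ k) ^+ i) ^+ d.+1 =
  p%:R * a ^+ p * gbinom_sum p d j (a ^+ p) T.
Proof.
move=> zP jp; have p0 := prim_order_gt0 zP.
under eq_bigr => k _ do rewrite homogeneous_geom_expr // mulr_sumr.
rewrite exchange_big /=.
pose G m := (gbinom p d.+1 m)%:R * T ^+ (p.-1 * d.+1 - m) *
  (p%:R * a ^+ (m + j)).
transitivity (\sum_(0 <= m < (p.-1 * d.+1).+1 | (p %| m + j)%N) G m).
  rewrite big_mkord [RHS]big_mkcond; apply: eq_bigr => m _.
  under eq_bigr => k _ do rewrite mulrCA -exprD.
  rewrite -mulr_sumr (sum_scaled_root_expr _ _ zP) addnC.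
  by case: ifP; rewrite ?mulr0.
rewrite sum_dvdn // /gbinom_sum.
have -> : ((p.-1 * d.+1).+1 + j.-1 = ((p - 1) * d + j.-1) + p)%N.
  by rewrite subn1 mulnS; lia.
rewrite divnDr // divnn p0 addn1.
rewrite mulr_sumr; apply: eq_bigr => k _; rewrite /G subnK; last by lia.
have -> : (p.-1 * d.+1 - (p * k.+1 - j) = d * (p - 1) + j.-1 - p * k)%N.
  by rewrite subn1 (mulnC d) !mulnS; lia.
rewrite mulnS exprD exprM; ring.
Qed.

(** * Partial fractions for X^p - a^p *)

(** The quotient of [X^p - w^p] by [X - w]. *)
Definition XnsubC_quot (F : fieldType) (p : nat) (w : F) : {poly F} :=
  \sum_(i < p) 'X ^+ (p.-1 - i) * w%:P ^+ i.

Lemma XnsubC_factor (F : fieldType) (p : nat) (z a : F) (k : nat) :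
  p.-primitive_root z ->
  'X^p - (a ^+ p)%:P = ('X - (a * z ^+ k)%:P) * XnsubC_quot p (a * z ^+ k).
Proof.
move=> zP; rewrite /XnsubC_quot -subrXX -rmorphXn exprMn exprAC.
by rewrite (prim_expr_order zP) expr1n mulr1.
Qed.

Lemma horner_XnsubC_quot (F : fieldType) (p : nat) (w T : F) :
  (XnsubC_quot p w).[T] = \sum_(i < p) T ^+ (p.-1 - i) * w ^+ i.
Proof.
rewrite horner_sum; apply: eq_bigr => i _.
by rewrite hornerM !horner_exp hornerX hornerC.
Qed.

(** The coefficient of ['X^(p-1-i)] is a multiple of the sum of the [(i+1)]-st
powers of the roots, which vanishes unless [i = p - 1]. *)
Lemma sum_partial_fraction_XnsubC (F : fieldType) (p : nat) (z a : F) :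
  p.-primitive_root z -> a != 0 ->
  \sum_(k < p) ((a * z ^+ k) / (p%:R * a ^+ p)) *:
     XnsubC_quot p (a * z ^+ k) = 1.
Proof.
move=> zP a0; have p0 := prim_order_gt0 zP.
have pa0 : p%:R * a ^+ p != 0.
  by rewrite mulf_neq0 ?expf_neq0 // (prim_root_natf_neq0 zP).
under eq_bigr => k _ do rewrite scaler_sumr.
rewrite exchange_big /=.
have inner (i : 'I_p) :
    \sum_(k < p) (a * z ^+ k / (p%:R * a ^+ p)) *:
      ('X ^+ (p.-1 - i) * (a * z ^+ k)%:P ^+ i) =
    (if (p %| i.+1)%N then (p%:R * a ^+ i.+1) / (p%:R * a ^+ p) else 0) *:
      'X ^+ (p.-1 - i).
  under eq_bigr => k _.
    rewrite -rmorphXn [_ * _%:P]mulrC mul_polyC scalerA mulrAC -exprS.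
    over.
  rewrite -scaler_suml -mulr_suml (sum_scaled_root_expr _ _ zP).
  by case: ifP; rewrite ?mul0r.
have lt_pred : (p.-1 < p)%N by rewrite ltn_predL.
rewrite (bigD1 (Ordinal lt_pred)) // inner /= prednK // dvdnn divff //.
rewrite scale1r subnn expr0.
rewrite big1 ?addr0 // => i ip; rewrite [LHS]inner ifF ?scale0r //.
apply/negP => /dvdn_leq /= /(_ isT) pi.
by case/eqP: ip; apply/val_inj => /=; have := ltn_ord i; lia.
Qed.

Lemma recip_num_XnsubC_horner (F : fieldType) (p d : nat) (z a T : F) :
  p.-primitive_root z -> a != 0 ->
  (recip_num ('X^p - (a ^+ p)%:P) d).[T] = ((-1) ^+ d * d`!%:R) *
    \sum_(k < p) (a * z ^+ k) / (p%:R * a ^+ p) *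
      (XnsubC_quot p (a * z ^+ k)).[T] ^+ d.+1.
Proof.
move=> zP a0; rewrite (recip_num_partial_fraction _
  (fun k : 'I_p => XnsubC_factor a k zP) (sum_partial_fraction_XnsubC zP a0)).
rewrite hornerZ horner_sum; congr (_ * _).
by apply: eq_bigr => k _; rewrite hornerZ horner_exp.
Qed.

Lemma sum_quot_expr (F : fieldType) (p d j : nat) (z a T : F) :
  p.-primitive_root z -> (0 < j <= p)%N ->
  \sum_(k < p) (a * z ^+ k) ^+ j * (XnsubC_quot p (a * z ^+ k)).[T] ^+ d.+1 =
  p%:R * a ^+ p * gbinom_sum p d j (a ^+ p) T.
Proof.
move=> zP jp; rewrite -(sum_root_geom_expr _ _ _ zP jp).
by apply: eq_bigr => k _; rewrite horner_XnsubC_quot.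
Qed.

Lemma recip_num_XnsubC (F : fieldType) (p d : nat) (z a T : F) :
  p.-primitive_root z -> a != 0 ->
  (recip_num ('X^p - (a ^+ p)%:P) d).[T] =
  ((-1) ^+ d * d`!%:R) * gbinom_sum p d 1 (a ^+ p) T.
Proof.
move=> zP a0.
have pa0 : p%:R * a ^+ p != 0.
  by rewrite mulf_neq0 ?expf_neq0 // (prim_root_natf_neq0 zP).
rewrite (recip_num_XnsubC_horner _ _ zP a0); congr (_ * _).
apply: (mulfI pa0); rewrite -(sum_quot_expr _ _ _ zP) ?(prim_order_gt0 zP) //.
rewrite mulr_sumr.
by apply: eq_bigr => k _; rewrite mulrA [_ * (_ / _)]mulrC divfK.
Qed.

(** The left-hand side is the numerator of [T g^(d+1) + (d+1) g^(d)] with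
[g = 1 / P].  On the term of the root [w] the combination is
[T L^(d+2) - (T - w) L L^(d+1) = w L^(d+2)], which is where the exponent of [w]
passes from 1 to 2. *)
Lemma recip_num_XnsubC_step (F : fieldType) (p d : nat) (z a T : F) :
  p.-primitive_root z -> a != 0 -> (1 < p)%N ->
  let P := 'X^p - (a ^+ p)%:P in
  T * (recip_num P d.+1).[T] + d.+1%:R * (P.[T] * (recip_num P d).[T]) =
  ((-1) ^+ d.+1 * d.+1`!%:R) * gbinom_sum p d.+1 2 (a ^+ p) T.
Proof.
move=> zP a0 p1 P.
have pa0 : p%:R * a ^+ p != 0.
  by rewrite mulf_neq0 ?expf_neq0 // (prim_root_natf_neq0 zP).
apply: (mulfI pa0); rewrite [RHS]mulrCA -(sum_quot_expr _ _ _ zP) //.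
rewrite !(recip_num_XnsubC_horner _ _ zP a0) factS natrM exprS.
rewrite !mulr_sumr -big_split mulr_sumr /=; apply: eq_bigr => k _.
have -> : P.[T] = (T - a * z ^+ k) * (XnsubC_quot p (a * z ^+ k)).[T].
  by rewrite /P (XnsubC_factor a k zP) hornerM hornerXsubC.
set L := (XnsubC_quot _ _).[T]; set w := a * z ^+ k.
rewrite (exprS L d.+1) (exprS L d); field.
by move: pa0; rewrite mulf_eq0 negb_or andbC.
Qed.

Lemma geom_homogeneous (F : fieldType) (p : nat) (T w : F) : w != 0 ->
  \sum_(i < p) T ^+ (p.-1 - i) * w ^+ i = w ^+ p.-1 * (Bpoly F p).[T / w].
Proof.
move=> w0; rewrite horner_sum mulr_sumr (reindex_inj rev_ord_inj) /=.
apply: eq_bigr => i _; rewrite hornerXn.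
have -> : (p.-1 - (p - i.+1) = i)%N by have := ltn_ord i; lia.
have -> : p.-1 = ((p - i.+1) + i)%N by have := ltn_ord i; lia.
by rewrite exprD expr_div_n; field; rewrite expf_neq0.
Qed.

(** With [w = a z^k], [T / w = z^(-k) (T / a)]: for [z = xi^(-1)] the right-hand
side is, up to a factor, a root of unity filter at [T / a]. *)
Lemma sum_quot_filter (F : fieldType) (p d j : nat) (z a T : F) :
  z != 0 -> a != 0 ->
  \sum_(k < p) (a * z ^+ k) ^+ j * (XnsubC_quot p (a * z ^+ k)).[T] ^+ d.+1 =
  a ^+ (j + p.-1 * d.+1) *
  \sum_(k < p) (z ^+ k) ^+ (j + p.-1 * d.+1) *
     (Bpoly F p).[z^-1 ^+ k * (T / a)] ^+ d.+1.
Proof.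
move=> z0 a0; rewrite mulr_sumr; apply: eq_bigr => k _.
have w0 : a * z ^+ k != 0 by rewrite mulf_neq0 ?expf_neq0.
rewrite horner_XnsubC_quot geom_homogeneous //; set w := a * z ^+ k.
rewrite [(_ * _.[_]) ^+ _]exprMn -[w ^+ p.-1 ^+ _]exprM.
rewrite [LHS]mulrA -[in LHS]exprD [w ^+ _]exprMn -mulrA.
congr (_ * (_ * _.[_] ^+ _)).
by rewrite /w exprVn invfM mulrA mulrC.
Qed.

(** * The root of unity filter *)

Lemma xiX (R : realType) (p k : nat) :
  xi R p ^+ k = cos (k%:R * (2 * pi / p%:R)) +i* sin (k%:R * (2 * pi / p%:R)).
Proof.
rewrite /xi; set u := 2 * pi / p%:R.
elim: k => [|k IH]; first by rewrite expr0 mul0r cos0 sin0.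
rewrite exprS IH -natr1 mulrDl mul1r addrC cosD sinD.
by apply/eqP; rewrite eq_complex /= eqxx /= [X in _ == X]addrC.
Qed.

(** If [xi ^+ m = 1] with [0 < m < p], then [cos (2 y) = 1] for
[y = m pi / p], hence [sin y = 0], although [0 < y < pi]. *)
Lemma xi_prim (R : realType) (p : nat) :
  (0 < p)%N -> p.-primitive_root (xi R p).
Proof.
move=> p0; rewrite /primitive_root_of_unity p0 /=; apply/forallP => i.
have pR0 : (p%:R : R) != 0 by rewrite pnatr_eq0 -lt0n.
rewrite unity_rootE; apply/eqP.
have [ip | ip] := eqVneq i.+1 p.
  rewrite ip xiX mulrC divfK // mulrC mulr_natr cos2pi sin2pi; exact: eqxx.
apply/negP; rewrite xiX eq_complex /= => /andP[/eqP cos1 _].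
pose y : R := i.+1%:R * pi / p%:R.
have yE : i.+1%:R * (2 * pi / p%:R) = y *+ 2 by rewrite /y; field.
have sin_pos : 0 < sin y.
  have ltip : (i.+1 < p)%N by rewrite ltn_neqAle ip ltn_ord.
  apply: sin_gt0_pi; rewrite /y divr_gt0 ?mulr_gt0 ?pi_gt0 ?ltr0n //=.
  by rewrite ltr_pdivrMr ?ltr0n // mulrC ltr_pM2l ?pi_gt0 // ltr_nat.
move: cos1; rewrite yE cos_mulr2n cos2sin2 => s0.
have : sin y ^+ 2 = 0 by lra.
by move/eqP; rewrite sqrf_eq0 gt_eqF.
Qed.

Lemma unity_filterE (R : realType) (p : nat) (l : int) (e : nat)
    (f : R[i] -> R[i]) (t : R[i]) : (0 < p)%N -> (l = e %[mod p])%Z ->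
  unity_filter p l f t =
  p%:R^-1 * \sum_(k < p) (((xi R p)^-1) ^+ k) ^+ e * f (xi R p ^+ k * t).
Proof.
move=> p0 le; have xP := xi_prim R p0.
have x0 : xi R p != 0 by rewrite (prim_root_eq0 xP) -lt0n.
have xl : xi R p ^ l = xi R p ^+ e.
  move/eqP: le; rewrite eqz_mod_dvd => /dvdzP[q lE].
  have -> : l = p%:Z * q + e%:Z by rewrite mulrC -lE subrK.
  by rewrite expfzDr // -exprz_exp -exprnP (prim_expr_order xP) exp1rz mul1r.
rewrite /unity_filter; congr (_ * _); apply: eq_bigr => k _; congr (_ * _).
by rewrite -mulrN -exprz_exp xl -exprnN exprAC !exprVn.
Qed.

Lemma xi_inv_prim (R : realType) (p : nat) : (0 < p)%N ->
  p.-primitive_root (xi R p)^-1.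
Proof.
move=> p0; have xP := xi_prim R p0.
have -> : (xi R p)^-1 = xi R p ^+ p.-1.
  apply: (@mulfI _ (xi R p)); first by rewrite (prim_root_eq0 xP) -lt0n.
  rewrite -exprS prednK // (prim_expr_order xP) divff //.
  by rewrite (prim_root_eq0 xP) -lt0n.
by rewrite (prim_root_exp_coprime _ xP) coprime_sym -{1}(prednK p0) coprimeSn.
Qed.

(** The congruence on [l] comes from [j + (p-1)(d+1)], the total exponent of the
root, which is [j - (d+1)] modulo [p]. *)
Lemma unity_filter_gbinom_sum (R : realType) (p d j : nat) (l : int)
    (a T : R[i]) :
  (0 < j <= p)%N -> a != 0 -> (l = j%:Z - d.+1%:Z %[mod p])%Z ->
  p%:R * a ^+ p * gbinom_sum p d j (a ^+ p) T =
  a ^+ (j + p.-1 * d.+1) *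
    (p%:R * unity_filter p l (fun s => (Bpoly R[i] p).[s] ^+ d.+1) (T / a)).
Proof.
move=> jp a0 lE; have p0 : (0 < p)%N by lia.
have zP := xi_inv_prim R p0.
have z0 : (xi R p)^-1 != 0 by rewrite (prim_root_eq0 zP) -lt0n.
rewrite -(sum_quot_expr _ _ _ zP jp) sum_quot_filter //; congr (_ * _).
have lE' : (l = (j + p.-1 * d.+1)%N %[mod p])%Z.
  rewrite lE; apply/eqP; rewrite eqz_mod_dvd; apply/dvdzP; exists (- d.+1%:Z).
  by case: (p) p0 => // q _ /=; rewrite PoszD PoszM (intS q); ring.
have pC0 := prim_root_natf_neq0 zP.
rewrite (@unity_filterE R p l (j + p.-1 * d.+1) _ (T / a) p0 lE').
rewrite mulrA mulfV // mul1r; apply: eq_bigr => k _.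
by rewrite [in LHS]invrK.
Qed.

Lemma rmorph_gbinom_sum (A B : nzSemiRingType) (f : {rmorphism A -> B})
    (p d j : nat) (X T : A) :
  f (gbinom_sum p d j X T) = gbinom_sum p d j (f X) (f T).
Proof.
rewrite rmorph_sum; apply: eq_bigr => k _.
by rewrite !rmorphM !rmorphXn rmorph_nat.
Qed.

(** * Householder's iteration *)

Theorem theorem12 (R : realType) (p d : nat) (x r : R)
    (hx : 0 < x) (hp : (2 <= p)%N) (hd : (1 <= d)%N)
    (hwd : householder_well_defined p d x r) :
  let H := householder p d x r in
  let BF := fun t : R[i] => (Bpoly R[i] p).[t] ^+ d.+1 in
  H 0%N = r /\
  forall n : nat,
    let t := (H n * x `^ (- p%:R^-1))%:C in
    let num := \sum_(0 <= k < (((p - 1) * d + 1) %/ p).+1)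
      (gbinom p d.+1 (p * k.+1 - 2))%:R * H n ^+ (d * (p - 1) + 1 - p * k)
        * x ^+ k in
    let den := \sum_(0 <= k < (((p - 1) * d) %/ p).+1)
      (gbinom p d.+1 (p * k.+1 - 1))%:R * H n ^+ (d * (p - 1) - p * k)
        * x ^+ k in
    [/\ unity_filter p ((- d%:Z) %% p%:Z)%Z BF t != 0,
        (H n.+1)%:C = (proot p x)%:C *
          (unity_filter p ((1 - d%:Z) %% p%:Z)%Z BF t /
           unity_filter p ((- d%:Z) %% p%:Z)%Z BF t),
        den != 0 &
        H n.+1 = num / den].
Proof.
move=> H BF; split=> // n t num den.
have p0 : (0 < p)%N by apply: ltnW.
have [Hp gd0] := hwd n; rewrite -/(H n) in Hp gd0.
pose h := H n; rewrite -/h in Hp gd0.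
pose a := proot p x; pose aC := a%:C.
have a_gt0 : 0 < a by exact: powR_gt0.
have aX : a ^+ p = x.
  rewrite -powR_mulrn ?ltW // -powRrM mulVf ?powRr1 ?ltW //.
  by rewrite pnatr_eq0 -lt0n.
have aC0 : aC != 0 by rewrite /aC fmorph_eq0 gt_eqF.
have aCX : aC ^+ p = x%:C by rewrite /aC -rmorphXn aX.
have tE : t = h%:C / aC by rewrite /t powRN rmorphM fmorphV.
have numE : num = gbinom_sum p d 2 x h by [].
have denE : den = gbinom_sum p d 1 x h by rewrite /gbinom_sum /= !addn0.
have numC : num%:C = gbinom_sum p d 2 (aC ^+ p) h%:C.
  by rewrite numE rmorph_gbinom_sum aCX.
have denC : den%:C = gbinom_sum p d 1 (aC ^+ p) h%:C.
  by rewrite denE rmorph_gbinom_sum aCX.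
pose P : {poly R} := 'X^p - x%:P.
have Ph : P.[h] != 0 by rewrite !hornerE subr_eq0.
have gpE : gp p x = fun s => P.[s]^-1.
  by apply/funext => s; rewrite /gp /P !hornerE.
have zP := xi_inv_prim R p0.
have NC m : ((recip_num P m).[h])%:C =
    (recip_num ('X^p - (aC ^+ p)%:P) m).[h%:C].
  rewrite -horner_map map_recip_num /P rmorphB /= map_polyXn map_polyC.
  by rewrite aCX.
have Nd : (recip_num P d).[h] = (-1) ^+ d * d`!%:R * den.
  apply: (fmorph_inj (real_complex R)); rewrite /= NC.
  rewrite (recip_num_XnsubC _ _ zP aC0) -denC.
  by rewrite !rmorphM rmorphXn rmorphN1 rmorph_nat.
have Nstep : h * (recip_num P d).[h] +
    d%:R * (P.[h] * (recip_num P d.-1).[h]) = (-1) ^+ d * d`!%:R * num.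
  apply: (fmorph_inj (real_complex R)).
  rewrite !rmorphM rmorphXn rmorphN1 rmorph_nat /= numC rmorphD !rmorphM /=.
  rewrite !NC rmorph_nat.
  have -> : (P.[h])%:C = ('X^p - (aC ^+ p)%:P).[h%:C].
    by rewrite !hornerE aCX rmorphB rmorphXn.
  by rewrite -(prednK hd) -(recip_num_XnsubC_step _ _ zP aC0).
have C0 : (-1) ^+ d * d`!%:R != 0 :> R.
  by rewrite mulf_neq0 ?signr_eq0 // pnatr_eq0 -lt0n fact_gt0.
have Nd0 : (recip_num P d).[h] != 0.
  move: gd0; rewrite gpE derive1n_recip //; apply: contra => /eqP->.
  by rewrite mul0r.
have den0 : den != 0.
  by apply: contra Nd0 => /eqP den0; rewrite Nd den0 mulr0.
have HS : H n.+1 = num / den.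
  rewrite /H /householder iterS -/(householder p d x r n) -/(H n) -/h.
  rewrite /householder_step gpE !derive1n_recip // prednK //.
  apply: (mulIf (mulf_neq0 C0 den0)); rewrite [RHS]mulrCA divfK // -Nstep -Nd.
  rewrite exprS; field.
  by rewrite Nd0 expf_neq0 // Ph.
have p1 : (0 < 1 <= p)%N by [].
have p2 : (0 < 2 <= p)%N by [].
have l1 : (((- d%:Z) %% p%:Z)%Z = 1%:Z - d.+1%:Z %[mod p%:Z])%Z.
  by rewrite modz_mod (intS d) opprD addrA subrr add0r.
have l2 : (((1 - d%:Z) %% p%:Z)%Z = 2%:Z - d.+1%:Z %[mod p%:Z])%Z.
  by rewrite modz_mod (intS d) opprD addrA.
have := unity_filter_gbinom_sum h%:C p2 aC0 l2.
have := unity_filter_gbinom_sum h%:C p1 aC0 l1.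
rewrite -numC -denC -tE -/BF.
(* The common factor of E1 and E2 cancels in their quotient, except for one
   power of a: the exponents of a are 1 + e and 2 + e. *)
set U1 := unity_filter _ _ _ _; set U2 := unity_filter _ _ _ _ => E1 E2.
have pC0 : (p%:R : R[i]) != 0 by rewrite pnatr_eq0 -lt0n.
have denC0 : den%:C != 0 by rewrite fmorph_eq0.
have aCX0 : aC ^+ p != 0 by rewrite expf_neq0.
have U1_0 : U1 != 0.
  have : p%:R * aC ^+ p * den%:C != 0 by rewrite !mulf_neq0.
  by rewrite E1 !mulf_eq0 !negb_or => /and3P[].
split=> //; rewrite HS rmorphM fmorphV /= -/a -/aC.
apply: (mulIf denC0); rewrite divfK //.
apply: (mulfI (mulf_neq0 pC0 aCX0)).
rewrite E2 [RHS]mulrCA [in RHS]E1 [(2 + _)%N]addSn exprS.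
by field.
Qed.
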